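(* For every nonnegative integer $\lambda\notin\{1,3,5,9,11,15\}$ there exists an independent Stanley sequence whose character is $\lambda$.
   Context: Let $\mathbb{N}_0$ denote the set of nonnegative integers. A set of integers is called 3-free if it contains no three distinct elements forming an arithmetic progression. Stanley sequence: given a finite 3-free set $A=\{a_0<a_1<\dots<a_n\}\subset\mathbb{N}_0$, the Stanley sequence $S(A)=(a_0,a_1,a_2,\dots)$ generated by $A$ is the infinite sequence starting with $a_0,\dots,a_n$ and defined recursively as follows: if $k\ge n$ and $a_0<\dots<a_k$ have been defined, then $a_{k+1}$ is the smallest integer $a_{k+1}>a_k$ such that $\{a_0,\dots,a_k\}\cup\{a_{k+1}\}$ is 3-free. Independent Stanley sequence and character: a Stanley sequence $S(A)=(a_n)$ is independent if there exist constants $\lambda=\lambda(A)$ and $\kappa=\kappa(A)$ such that for all $k\ge\kappa$ and all $0\le i<2^k$ we have $a_{2^k+i}=a_{2^k}+a_i$ and $a_{2^k}=2a_{2^k-1}-\lambda+1$. The constant $\lambda$ is called the character of the sequence. *)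

(* Defs.v *)
From mathcomp Require Import all_boot all_order all_algebra.

Set Implicit Arguments.
Unset Strict Implicit.
Unset Printing Implicit Defensive.

Import GRing.Theory.

(* [x; y; z] ranges over all orderings of a triple, so taking the middle term
   to be y loses no generality; the additive form avoids truncated
   subtraction. *)
Definition three_free (s : seq nat) : Prop :=
  forall x y z : nat, x \in s -> y \in s -> z \in s ->
    uniq [:: x; y; z] -> x + z <> 2 * y.

Definition admissible (a : nat -> nat) (k m : nat) : Prop :=
  a k < m /\ three_free (rcons (mkseq a k.+1) m).

(* [a] is the Stanley sequence S(A), where the nonempty finite set
   A = {a_0 < ... < a_n} is given by its increasing enumeration, so that
   n = (size A).-1 and the condition k >= n reads [size A <= k.+1].  A least
   admissible integer always exists (2 * a k + 1 is admissible), so A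
   determines exactly one such [a]. *)
Definition stanley (A : seq nat) (a : nat -> nat) : Prop :=
  [/\ A <> [::], sorted ltn A, three_free A, mkseq a (size A) = A &
      forall k, size A <= k.+1 ->
        admissible a k (a k.+1) /\
        forall m, admissible a k m -> a k.+1 <= m].

(* The second equation is stated over int, since its subtraction must not be
   truncated. *)
Definition independent_with (a : nat -> nat) (lambda : int) (kappa : nat) :
    Prop :=
  forall k, kappa <= k ->
    (forall i, i < 2 ^ k -> a (2 ^ k + i) = a (2 ^ k) + a i) /\
    ((a (2 ^ k)%N)%:Z = 2 * (a (2 ^ k - 1)%N)%:Z - lambda + 1)%R.

Definition independent (a : nat -> nat) : Prop :=
  exists lambda kappa, independent_with a lambda kappa.

(* At most one [lambda] satisfies this for a given [a]. *)
Definition has_character (a : nat -> nat) (lambda : int) : Prop :=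
  exists kappa, independent_with a lambda kappa.

(* Main.v *)
From Stdlib Require Import ZArith.
Require Import Defs.
From mathcomp Require Import all_boot all_order all_algebra.
From mathcomp Require Import zify.

(* A finite set A of 2^n integers in [0, N) containing 0 is called modular if it
   is free of progressions mod N and every other residue is 2y - x mod N with
   x < y in A.  Then A + N S({0}) is an independent Stanley sequence of
   character 2 max A + 1 - N, where S({0}) is the set of integers whose ternary
   digits are 0 or 1.  Multiplying A by {0, 1} or {0, 2} mod 3 turns a character
   l into 3l or 3l + 2, so only l = 1 mod 3 has to be realised directly.

   For this take A to be a union of translates of the first K = 3^k integers of
   S({0}) by t_0 < ... < t_m.  Since the differences 2y - x of such a block fill
   the interval ]-K/2, K[, modularity of A becomes a system of linear
   inequalities, homogeneous in (K, N, t): if a few integer vectors satisfy the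
   same inequalities, so does the cone they span.  Nine explicit cones produce
   every character l = 1 mod 3 with l >= 972.  Of the smaller values, 37 are
   reached neither by these cones nor by the reduction (which fails for instance
   at 17 = 3 * 5 + 2); each of them is given by one explicit vector. *)

Set Implicit Arguments.
Unset Strict Implicit.
Unset Printing Implicit Defensive.

(** * Ternary numbers with digits 0 and 1 *)

(** Binary digits are read in base 3, so [ternary] enumerates S({0}). Fuel replaces the
    non-structural recursion on [n./2]. *)
Fixpoint ternary_rec (fuel n : nat) : nat :=
  if fuel is fuel'.+1 then 3 * ternary_rec fuel' n./2 + odd n else 0.

Definition ternary (n : nat) : nat := ternary_rec n n.

Lemma ternary_rec_fuel f g n : n <= f -> n <= g -> ternary_rec f n = ternary_rec g n.
Proof.
elim: f g n => [|f IH] [|g] n //=; rewrite ?leqn0.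
- move=> /eqP-> _; elim: g => //= g <-; lia.
- move=> _ /eqP->; elim: f {IH} => //= f ->; lia.
by move=> nf ng; rewrite (IH g) //; lia.
Qed.

Lemma ternaryE n : ternary n = 3 * ternary n./2 + odd n.
Proof.
rewrite /ternary; case: n => // n.
by rewrite [in LHS]/= (@ternary_rec_fuel n (n.+1)./2) //; lia.
Qed.

Lemma ternary0 : ternary 0 = 0. Proof. by []. Qed.

Lemma ternary_double n (b : bool) : ternary (b + n.*2) = 3 * ternary n + b.
Proof.
rewrite ternaryE; have -> : (b + n.*2)./2 = n by lia.
by have -> : odd (b + n.*2) = b by lia.
Qed.

Lemma ternary_ltn m n : m < n -> ternary m < ternary n.
Proof.
elim/ltn_ind: n m => n IH m mn.
rewrite (ternaryE m) (ternaryE n).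
case: (ltnP m./2 n./2) => h; first by have := IH n./2 ltac:(lia) _ h; lia.
have -> : m./2 = n./2 by lia.
lia.
Qed.

Lemma ternary_leq m n : m <= n -> ternary m <= ternary n.
Proof. by rewrite leq_eqVlt => /orP[/eqP->|/ternary_ltn/ltnW]. Qed.

Lemma ternary_pow2D k i : i < 2 ^ k -> ternary (2 ^ k + i) = 3 ^ k + ternary i.
Proof.
elim: k i => [|k IH] i; first by case: i.
rewrite !expnS => h.
rewrite ternaryE (ternaryE i).
have -> : (2 * 2 ^ k + i)./2 = 2 ^ k + i./2 by lia.
have -> : odd (2 * 2 ^ k + i) = odd i by lia.
by rewrite IH; lia.
Qed.

Lemma ternary_pred_pow2 k : (2 * ternary (2 ^ k - 1)).+1 = 3 ^ k.
Proof.
elim: k => // k IH; rewrite ternaryE !expnS.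
have := expn_gt0 2 k => /= p.
have -> : (2 * 2 ^ k - 1)./2 = 2 ^ k - 1 by lia.
have -> : odd (2 * 2 ^ k - 1) by lia.
rewrite /=; lia.
Qed.

Lemma ternary_bound k i : i < 2 ^ k -> 2 * ternary i < 3 ^ k.
Proof.
move=> h; rewrite -ternary_pred_pow2.
have := @ternary_leq i (2 ^ k - 1); lia.
Qed.

(** Modulo 3 the last digits, 0 or 1, must all agree; halving the indices removes them. *)
Lemma ternary_three_free i j l : ternary i + ternary l = 2 * ternary j -> i = j.
Proof.
elim/ltn_ind: i j l => i IH j l.
(* Halving does not decrease [i = 0], so that case is an induction on [l]. *)
case: (posnP i) => [->|i0].
  rewrite ternary0 add0n.
  elim/ltn_ind: l j => l IHl j e.
  case: (posnP l) => [l0|l0].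
    rewrite l0 in e.
    case: (posnP j) => // /ternary_ltn; rewrite ternary0; move: e; rewrite ternary0; lia.
  move: e; rewrite (ternaryE l) (ternaryE j) => e.
  have := IHl l./2 ltac:(lia) j./2; lia.
rewrite (ternaryE i) (ternaryE l) (ternaryE j) => e.
have := IH i./2 ltac:(lia) j./2 l./2; lia.
Qed.

(* Digitwise, 0 = 2*0 - 0, 1 = 2*1 - 1 and 2 = 2*1 - 0. *)
Lemma ternary_cover k u : u < 3 ^ k ->
  exists x y, [/\ x <= y, y < 2 ^ k & u + ternary x = 2 * ternary y].
Proof.
elim: k u => [|k IH] u; first by case: u => // _; exists 0, 0.
rewrite !expnS => h.
have [|x [y [xy yk e]]] := IH (u %/ 3); first lia.
exists ((u %% 3 == 1) + x.*2), ((u %% 3 != 0) + y.*2).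
rewrite !ternary_double; split; lia.
Qed.

(* Digitwise, 0 = 0 - 2*0, 1 = 1 - 2*0 and -1 = 1 - 2*1. *)
Lemma ternary_cover_neg k u : 2 * u < 3 ^ k ->
  exists x y, [/\ x < 2 ^ k, y < 2 ^ k & ternary x = 2 * ternary y + u].
Proof.
elim: k u => [|k IH] u; first by case: u => // _; exists 0, 0.
rewrite !expnS => h.
have o : odd (3 ^ k) by rewrite oddX orbT.
have [|x [y [xk yk e]]] := IH ((u + 1) %/ 3); first lia.
exists ((u %% 3 != 0) + x.*2), ((u %% 3 == 2) + y.*2).
rewrite !ternary_double; split; lia.
Qed.

(** * Modular sets and their Stanley sequences *)

(* In [modular_cover] the shift by N keeps e nonnegative. *)
Record modular_set (n N : nat) (f : nat -> nat) : Prop := ModularSet {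
  modular_0 : f 0 = 0;
  modular_ltn : forall i j, i < j -> j < 2 ^ n -> f i < f j;
  modular_bound : forall i, i < 2 ^ n -> f i < N;
  modular_free : forall i j l e e', i < 2 ^ n -> j < 2 ^ n -> l < 2 ^ n ->
    f i + f l + e * N = 2 * f j + e' * N -> i = j;
  modular_cover : forall c, c < N ->
    (exists2 i, i < 2 ^ n & f i = c) \/
    exists i j e, [/\ i < j, j < 2 ^ n & f i + c + N = 2 * f j + e * N] }.

(** * The sequence A + N S({0}) *)

Section Extension.
Variables (n N : nat) (f : nat -> nat).
Hypothesis fP : modular_set n N f.

Definition extension (i : nat) : nat := f (i %% 2 ^ n) + N * ternary (i %/ 2 ^ n).

Let p2_gt0 k : 0 < 2 ^ k. Proof. by rewrite expn_gt0. Qed.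

Let N_gt0 : 0 < N.
Proof. by have := modular_bound fP (p2_gt0 n); lia. Qed.

Lemma extensionD i q : i < 2 ^ n -> extension (q * 2 ^ n + i) = f i + N * ternary q.
Proof.
move=> h; rewrite /extension modnMDl modn_small // divnMDl ?divn_small //.
by rewrite addn0.
Qed.

Lemma extension_ltn i j : i < j -> extension i < extension j.
Proof.
move=> ij; rewrite /extension.
have hi := ltn_pmod i (p2_gt0 n); have hj := ltn_pmod j (p2_gt0 n).
have Ei := divn_eq i (2 ^ n); have Ej := divn_eq j (2 ^ n).
have bi := modular_bound fP hi.
case: (ltngtP (i %/ 2 ^ n) (j %/ 2 ^ n)) => h.
- have := ternary_ltn h; nia.
- nia.
- rewrite h in Ei *; rewrite ltn_add2r; apply: (modular_ltn fP) => //; lia.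
Qed.

Lemma extension_leq : {mono extension : i j / i <= j}.
Proof. by apply: leq_mono => i j; exact: extension_ltn. Qed.

Lemma extension_three_free i j l :
  extension i + extension l = 2 * extension j -> i = j.
Proof.
rewrite /extension => E.
have hi := ltn_pmod i (p2_gt0 n); have hj := ltn_pmod j (p2_gt0 n).
have hl := ltn_pmod l (p2_gt0 n).
set I := i %/ _ in E *; set J := j %/ _ in E *; set L := l %/ _ in E *.
have ij : i %% 2 ^ n = j %% 2 ^ n.
  by apply: (modular_free fP (e := ternary I + ternary L) (e' := 2 * ternary J) hi hj hl); nia.
have lj : l %% 2 ^ n = j %% 2 ^ n.
  by apply: (modular_free fP (e := ternary I + ternary L) (e' := 2 * ternary J) hl hj hi); nia.
have /ternary_three_free IJ : ternary I + ternary L = 2 * ternary J.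
  by rewrite ij lj in E; nia.
by rewrite (divn_eq i (2 ^ n)) (divn_eq j (2 ^ n)) -/I -/J IJ ij.
Qed.

(** The remainder of [m] modulo N is handled by [modular_cover], the quotient by [ternary_cover]. *)
Lemma extension_cover m : N <= m ->
  (exists i, extension i = m) \/
  exists i j, i < j /\ extension i + m = 2 * extension j.
Proof.
move=> Nm; have hc := ltn_pmod m N_gt0.
have Em := divn_eq m N; set d := m %/ N in Em; set c := m %% N in Em hc.
have d1 : 0 < d by rewrite divn_gt0.
have big u : u < 3 ^ u by apply: ltn_expl.
case: (modular_cover fP hc) => [[i hi fi]|[i [j [e [ij hj E]]]]].
  have [x [y [xy _ E]]] := ternary_cover (big d).
  move: xy; rewrite leq_eqVlt => /orP[/eqP xy|xy].
    left; exists (y * 2 ^ n + i); rewrite extensionD // fi Em; subst x.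
    have -> : d = ternary y by lia.
    lia.
  right; exists (x * 2 ^ n + i), (y * 2 ^ n + i).
  rewrite !extensionD // fi Em; split; first by have := p2_gt0 n; nia.
  nia.
have hi := ltn_trans ij hj.
have fi := modular_bound fP hi; have fj := modular_bound fP hj.
(* The relation modulo N carries [e - 1] into the quotient; [0 < d] prevents truncation. Even if x =
   y, [i < j] separates the two terms. *)
have [x [y [xy _ F]]] := ternary_cover (big (d + e - 1)).
right; exists (x * 2 ^ n + i), (y * 2 ^ n + j).
rewrite !extensionD // Em; split; first by nia.
nia.
Qed.

Lemma extension_three_free_seq (s : seq nat) :
  (forall x, x \in s -> exists i, extension i = x) -> three_free s.
Proof.
move=> sub x y z /sub[i <-] /sub[j <-] /sub[l <-] /=.
rewrite inE negb_or => /andP[/andP[xy _] _] E.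
by rewrite (extension_three_free E) eqxx in xy.
Qed.

(** The generating set includes the term N because [extension_cover] only concerns integers from N
    on. By it, an admissible integer before the next term would be a term or complete a
    progression. *)
Lemma extension_stanley : stanley (mkseq extension (2 ^ n).+1) extension.
Proof.
split.
- by [].
- rewrite sorted_map; apply: sub_sorted (iota_ltn_sorted 0 (2 ^ n).+1).
  by move=> i j; exact: extension_ltn.
- by apply: extension_three_free_seq => x /mapP[i _ ->]; exists i.
- by rewrite size_mkseq.
rewrite size_mkseq => k nk; split.
  split; first exact: extension_ltn.
  apply: extension_three_free_seq => x; rewrite mem_rcons inE => /orP[/eqP->|/mapP[i _ ->]].
    by exists k.+1.
  by exists i.
move=> m [km free]; rewrite leqNgt; apply/negP => mk.
have Nm : N <= m.
  apply: leq_trans (ltnW km); apply: (leq_trans _ (_ : extension (2 ^ n) <= _)).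
    by have := extensionD 1 (p2_gt0 n); rewrite mul1n addn0 => ->; rewrite (modular_0 fP) muln1.
  by rewrite extension_leq.
case: (extension_cover Nm) => [[i Ei]|[i [j [ij E]]]].
  have mono := leqW_mono extension_leq.
  by move: km mk; rewrite -Ei !mono; lia.
have lti := extension_ltn ij.
have jk : j <= k.
  by rewrite -ltnS -(leqW_mono extension_leq); lia.
have mem h : h <= k -> extension h \in rcons (mkseq extension k.+1) m.
  by move=> hk; rewrite mem_rcons inE map_f ?orbT // mem_iota.
apply: (free (extension i) (extension j) m) => //; try exact: mem; try (apply: mem; lia).
  by rewrite mem_rcons mem_head.
rewrite /= !inE; lia.
Qed.

(** For k >= n the terms of index 2^k and 2^k - 1 are N 3^(k-n) and max A + N (3^(k-n) - 1) / 2, so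
    the powers of 3 cancel in the character. *)
Lemma extension_character (lambda : nat) : N + lambda = (2 * f (2 ^ n - 1)).+1 ->
  has_character extension (Posz lambda).
Proof.
move=> E; exists n => k nk; have Ek : 2 ^ k = 2 ^ (k - n) * 2 ^ n by rewrite -expnD subnK.
have E2k : extension (2 ^ k) = N * 3 ^ (k - n).
  rewrite Ek -[_ * _]addn0 extensionD // (modular_0 fP).
  by rewrite -[2 ^ _]addn0 ternary_pow2D // ternary0 !addn0.
split.
  move=> i; rewrite E2k Ek => hi.
  have hm := ltn_pmod i (p2_gt0 n).
  rewrite [in LHS](divn_eq i (2 ^ n)) addnA -mulnDl extensionD //.
  by rewrite ternary_pow2D ?ltn_divLR // /extension; nia.
have -> : 2 ^ k - 1 = (2 ^ (k - n) - 1) * 2 ^ n + (2 ^ n - 1).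
  by have := p2_gt0 n; have := p2_gt0 (k - n); rewrite Ek; nia.
rewrite E2k extensionD; last by have := p2_gt0 n; lia.
have := ternary_pred_pow2 (k - n); nia.
Qed.

End Extension.

(** * Characters of modular sets and their tripling *)

Definition is_character (lambda : nat) : Prop :=
  exists n N f, modular_set n N f /\ N + lambda = (2 * f (2 ^ n - 1)).+1.

Lemma is_character_stanley lambda : is_character lambda ->
  exists (A : seq nat) (a : nat -> nat),
    [/\ stanley A a, independent a & has_character a (Posz lambda)].
Proof.
move=> [n [N [f [fP E]]]]; have H := extension_character fP E.
exists (mkseq (extension n N f) (2 ^ n).+1), (extension n N f); split=> //.
  exact: extension_stanley.
by exists (Posz lambda).
Qed.

(** The new last ternary digit is 0 or b + 1. Residues ending in these come from pairs with equal
    digits; the third digit is 2 (b + 1) - 0 modulo 3. *)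
Lemma is_character_triple (b : bool) lambda :
  is_character lambda -> is_character (3 * lambda + b.*2).
Proof.
move=> [n [N [f [[f0 fltn fbound ffree fcover] E]]]].
have p2 : 0 < 2 ^ n by rewrite expn_gt0.
have p2S : 2 ^ n.+1 = 2 * 2 ^ n by rewrite expnS.
have N0 : 0 < N by have := fbound _ p2; lia.
pose g (i : nat) := odd i * b.+1 + 3 * f i./2.
have gE (o : bool) i : g (o + i.*2) = o * b.+1 + 3 * f i.
  rewrite /g; have -> : (o + i.*2)./2 = i by lia.
  by have -> : odd (o + i.*2) = o by lia.
have gbound i : i < 2 ^ n.+1 -> g i < 3 * N.
  by rewrite p2S /g => hi; have := fbound i./2; lia.
exists n.+1, (3 * N), g; split; last first.
  have -> : 2 ^ n.+1 - 1 = true + (2 ^ n - 1).*2 by lia.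
  by rewrite gE; lia.
split.
- by rewrite /g f0.
- move=> i j ij; rewrite p2S => hj; rewrite /g.
  case: (ltnP i./2 j./2) => h; first by have := fltn _ _ h; lia.
  have -> : j./2 = i./2 by lia.
  lia.
- exact: gbound.
- move=> i j l e e'; rewrite p2S /g => hi hj hl H.
  have [oij oil] : odd i = odd j /\ odd l = odd j by move: (odd i) (odd j) (odd l) b H {E gE g gbound} => [] [] [] []; lia.
  have := ffree i./2 j./2 l./2 e e'; rewrite oij oil in H.
  lia.
move=> c hc.
(* As [o < o'] already orders the new indices, an old element may be paired with itself, so every
   residue [c'] is available. *)
have step (o o' : bool) c' : c' < N -> o < o' ->
    exists i j e, [/\ i < j, j < 2 ^ n.+1 & g i + (3 * c' + 2 * o' * b.+1 - o * b.+1) + 3 * N = 2 * g j + e * (3 * N)].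
  move=> hc' oo; case: (fcover _ hc') => [[i hi fi]|[i [j [e [ij hj fe]]]]].
    exists (o + i.*2), (o' + i.*2), 1; rewrite !gE p2S; split; lia.
  exists (o + i.*2), (o' + j.*2), e; rewrite !gE p2S; split; nia.
have same (o : bool) c' : c' < N ->
    (exists2 i, i < 2 ^ n.+1 & g i = o * b.+1 + 3 * c') \/
    exists i j e, [/\ i < j, j < 2 ^ n.+1 & g i + (o * b.+1 + 3 * c') + 3 * N = 2 * g j + e * (3 * N)].
  move=> hc'; case: (fcover _ hc') => [[i hi fi]|[i [j [e [ij hj fe]]]]].
    by left; exists (o + i.*2); rewrite ?gE ?p2S; lia.
  by right; exists (o + i.*2), (o + j.*2), e; rewrite !gE p2S; split; nia.
have c3 : c %/ 3 < N by lia.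
case: (boolP (c %% 3 == 0)) => r0.
  have -> : c = false * b.+1 + 3 * (c %/ 3) by lia.
  exact: same.
case: (boolP (c %% 3 == b.+1)) => r1.
  have -> : c = true * b.+1 + 3 * (c %/ 3) by lia.
  exact: same.
clearbody g; right; case: b {E same gE} step r1 => step r1; last first.
  have [//|//|i [j [e [ij hj H]]]] := step false true (c %/ 3).
  by exists i, j, e; split=> //; move: H r0 r1 => /=; lia.
(* For [b = true] the digit 2 (b + 1) = 4 carries 1 into the quotient, which wraps around to N - 1
   when c = 1. *)
case: (posnP (c %/ 3)) => q0.
  have [|//|i [j [e [ij hj H]]]] := step false true (N - 1); first lia.
  have gj := gbound _ hj.
  have c1 : c = 1 by move: r0 r1 => /=; lia.
  case: e H => [|e] H; first by move: H => /=; lia.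
  by exists i, j, e; split=> //; move: H => /=; lia.
have [|//|i [j [e [ij hj H]]]] := step false true (c %/ 3 - 1); first lia.
by exists i, j, e; split=> //; move: H r0 r1 => /=; lia.
Qed.

(** * Unions of translated blocks *)

(* The key %Z is taken over by the integers of MathComp. *)
Delimit Scope Z_scope with BZ.
Local Arguments Z.mul : simpl never.
Local Arguments Z.add : simpl never.

(* [offset p i] is the position t_i of the i-th block, [width p] is K and
   [period p] is N. *)
Record config := Config { width : Z; period : Z; offset : nat -> Z }.

Definition config0 : config := Config 0 0 (fun=> 0%BZ).

Definition config_addn (p : config) (c : nat) (p' : config) : config :=
  Config (Z.of_nat c * width p + width p') (Z.of_nat c * period p + period p')
    (fun i => Z.of_nat c * offset p i + offset p' i)%BZ.

(* The residues 2y - x, for x in block i and y in block j, form the interval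
   ]mid - K/2, mid + K[; if i = j only those in [mid, mid + K[ have x <= y.
   The endpoints are doubled to stay integral. *)
Definition mid (p : config) (x : nat * nat * Z) : Z :=
  let: (i, j, q) := x in
  ((if i == j then offset p i else 2 * offset p j - offset p i) + q * period p)%BZ.

Definition lower2 (p : config) (x : nat * nat * Z) : Z :=
  (2 * mid p x - (if x.1.1 == x.1.2 then 0 else width p))%BZ.

Definition upper2 (p : config) (x : nat * nat * Z) : Z :=
  (2 * (mid p x + width p))%BZ.

(* Each interval starts before the end of the previous one, so that they cover
   [0, N[. *)
Fixpoint chained (p : config) (e : Z) (ch : seq (nat * nat * Z)) : bool :=
  if ch is x :: ch' then (lower2 p x <=? e)%BZ && chained p (upper2 p x) ch'
  else (2 * period p <=? e)%BZ.

(** Positions inside the blocks change [d] by less than K, so x + z - 2y stays strictly between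
    consecutive multiples of N. *)
Definition triple_gap (p : config) (i j l : nat) (q : Z) : bool :=
  let d := (offset p i + offset p l - 2 * offset p j - q * period p)%BZ in
  (width p <=? d)%BZ && (d + width p <=? period p)%BZ.

(* For fixed q and ch, all conditions are homogeneous linear inequalities in p. *)
Section Validity.
Variables (n : nat) (q : nat -> nat -> nat -> Z) (ch : seq (nat * nat * Z)).

Definition valid (p : config) : bool :=
  [&& (offset p 0 =? 0)%BZ, (width p <=? period p)%BZ,
      (2 * offset p n.-1 + width p <=? 2 * period p)%BZ,
      all (fun i => (i.+1 == n) || (offset p i + width p <=? offset p i.+1)%BZ) (iota 0 n),
      all (fun i => all (fun j => all (fun l =>
        (i == j) && (j == l) || triple_gap p i j l (q i j l)) (iota 0 n)) (iota 0 n)) (iota 0 n)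
    & chained p 0 ch].

Lemma chained_addn p c p' e e' s : chained p e s -> chained p' e' s ->
  chained (config_addn p c p') (Z.of_nat c * e + e') s.
Proof.
elim: s e e' => [|[[i j] qq] s IH] e e' /=.
  by move=> /Z.leb_le h /Z.leb_le h'; apply/Z.leb_le; nia.
move=> /andP[/Z.leb_le h1 h2] /andP[/Z.leb_le h1' h2']; apply/andP; split.
  by apply/Z.leb_le; move: h1 h1'; rewrite /lower2 /=; case: eqP => _; nia.
suff -> : upper2 (config_addn p c p') (i, j, qq) =
  (Z.of_nat c * upper2 p (i, j, qq) + upper2 p' (i, j, qq))%BZ by exact: IH.
by rewrite /upper2 /=; case: eqP => _; lia.
Qed.

(** The conditions are equations and weak inequalities, so the zero vector can start the sums of
    [config_sum]. *)
Lemma valid0 : valid config0.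
Proof.
apply/and5P; split=> //.
  by apply/allP => i _; rewrite orbT.
apply/andP; split.
  apply/allP => i _; apply/allP => j _; apply/allP => l _.
  by rewrite /triple_gap /= Z.mul_0_r orbT.
elim: ch => [|[[i j] qq] s IH] //=; rewrite /lower2 /upper2 /= Z.mul_0_r.
by case: eqP.
Qed.

Lemma valid_addn p c p' : valid p -> valid p' -> valid (config_addn p c p').
Proof.
move=> /and5P[/Z.eqb_eq a1 /Z.leb_le a2 /Z.leb_le a3 /allP a4 /andP[/allP a5 a6]].
move=> /and5P[/Z.eqb_eq b1 /Z.leb_le b2 /Z.leb_le b3 /allP b4 /andP[/allP b5 b6]].
apply/and5P; split; try (first [apply/Z.eqb_eq | apply/Z.leb_le] => /=; nia).
  apply/allP => i hi; move: (a4 i hi) (b4 i hi); case: eqP => //= _.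
  by move=> /Z.leb_le h /Z.leb_le h'; apply/Z.leb_le; nia.
apply/andP; split; last by have := chained_addn c a6 b6; rewrite Z.mul_0_r.
apply/allP => i hi; apply/allP => j hj; apply/allP => l hl.
move: (allP (allP (a5 i hi) j hj) l hl) (allP (allP (b5 i hi) j hj) l hl).
case: (_ && _) => //=; rewrite /triple_gap /=.
move=> /andP[/Z.leb_le h1 /Z.leb_le h2] /andP[/Z.leb_le h1' /Z.leb_le h2'].
by apply/andP; split; apply/Z.leb_le; nia.
Qed.

(** The first link ending beyond [2 * c] contains it, as it starts no later than the previous one
    ends. *)
Lemma chainedP (P : pred (nat * nat * Z)) p e s c :
  all P s -> chained p e s -> (e <= 2 * c < 2 * period p)%BZ ->
  exists x, P x /\ (lower2 p x <= 2 * c < upper2 p x)%BZ.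
Proof.
elim: s e => [|x s IH] e /=; first by move=> _ /Z.leb_le; lia.
move=> /andP[hx hs] /andP[/Z.leb_le h1 h2] h.
case: (Z.ltb_spec (2 * c) (upper2 p x)) => hc; first by exists x; split=> //; lia.
by apply: IH hs h2 _; lia.
Qed.

End Validity.

(** An index splits into a block number and a position among the 2^k elements of a block. The
    maximum is the last offset plus (K - 1) / 2, whence the formula for [lambda]. *)
Lemma valid_modular (r k : nat) q ch p (lambda : nat) :
  all (fun x => x.1.1 <= x.1.2 < 2 ^ r) ch -> valid (2 ^ r) q ch p ->
  width p = Z.of_nat (3 ^ k) ->
  (Z.of_nat lambda = 2 * offset p (2 ^ r).-1 + width p - period p)%BZ ->
  is_character lambda.
Proof.
move=> chr /and5P[/Z.eqb_eq t0 /Z.leb_le KN /Z.leb_le tN /allP tS /andP[/allP free cov]].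
move=> EK El.
have r2 : 0 < 2 ^ r by rewrite expn_gt0.
have k2 : 0 < 2 ^ k by rewrite expn_gt0.
have K0 : 0 < 3 ^ k by rewrite expn_gt0.
have {}tS i : i.+1 < 2 ^ r -> (offset p i + width p <= offset p i.+1)%BZ.
  move=> hi; have := tS i; rewrite mem_iota add0n => /(_ ltac:(lia)).
  by case: eqP => [|_ /= /Z.leb_le //]; lia.
have tlt i j : i < j -> j < 2 ^ r -> (offset p i + width p <= offset p j)%BZ.
  elim: j => // j IH; rewrite ltnS leq_eqVlt => /orP[/eqP->|ij] hj; first exact: tS.
  by have := IH ij (ltnW hj); have := tS _ hj; lia.
have tge i : i < 2 ^ r -> (0 <= offset p i)%BZ.
  by case: (posnP i) => [->|i0 hi]; [lia | have := tlt _ _ i0 hi; lia].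
have tle i : i < 2 ^ r -> (offset p i <= offset p (2 ^ r).-1)%BZ.
  move=> hi; case: (ltngtP i (2 ^ r).-1) => h; [have := tlt _ _ h; lia | lia | rewrite h; lia].
pose M := Z.to_nat (period p); have EM : period p = Z.of_nat M by lia.
pose T i := Z.to_nat (offset p i).
have ET i : i < 2 ^ r -> offset p i = Z.of_nat (T i) by move=> /tge; rewrite /T; lia.
have KM : 3 ^ k <= M by lia.
have TM : 2 * T (2 ^ r).-1 + 3 ^ k <= 2 * M by have := ET (2 ^ r).-1; lia.
have Tle i : i < 2 ^ r -> T i <= T (2 ^ r).-1.
  by move=> hi; have := tle _ hi; rewrite !ET; lia.
have Tlt i j : i < j -> j < 2 ^ r -> T i + 3 ^ k <= T j.
  by move=> ij hj; have := tlt _ _ ij hj; rewrite !ET; lia.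
pose f i := T (i %/ 2 ^ k) + ternary (i %% 2 ^ k).
have fE i x : x < 2 ^ k -> f (i * 2 ^ k + x) = T i + ternary x.
  by move=> hx; rewrite /f divnMDl // modnMDl divn_small // addn0 modn_small.
have split_idx i : i < 2 ^ (r + k) -> exists j x, [/\ j < 2 ^ r, x < 2 ^ k & i = j * 2 ^ k + x].
  move=> hi; exists (i %/ 2 ^ k), (i %% 2 ^ k); rewrite ltn_mod ltn_divLR // -expnD.
  by split=> //; exact: divn_eq.
have join_idx i x : i < 2 ^ r -> x < 2 ^ k -> i * 2 ^ k + x < 2 ^ (r + k).
  by rewrite expnD; nia.
exists (r + k), M, f; split; last first.
  have -> : 2 ^ (r + k) - 1 = (2 ^ r).-1 * 2 ^ k + (2 ^ k - 1) by rewrite expnD; nia.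
  rewrite fE; last lia.
  have := ternary_pred_pow2 k; have := ET (2 ^ r).-1; lia.
split.
- by have := fE 0 0 k2; rewrite mul0n => ->; rewrite /T t0.
- move=> i j ij /[dup] hj /split_idx[J [y [hJ hy Ej]]].
  have /split_idx[I [x [hI hx Ei]]] := ltn_trans ij hj.
  rewrite Ei Ej !fE //; case: (ltngtP I J) => IJ; last first.
  + by subst J; rewrite ltn_add2l; apply: ternary_ltn; lia.
  + by exfalso; nia.
  by have := Tlt _ _ IJ hJ; have := ternary_bound hx; lia.
- move=> i /split_idx[I [x [hI hx ->]]]; rewrite fE //.
  by have := Tle _ hI; have := ternary_bound hx; lia.
- move=> i j l e e' /split_idx[I [x [hI hx Ei]]] /split_idx[J [y [hJ hy Ej]]].
  move=> /split_idx[L [z [hL hz El']]]; rewrite Ei Ej El' !fE // => E.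
  have bx := ternary_bound hx; have by_ := ternary_bound hy; have bz := ternary_bound hz.
  have := free I; rewrite mem_iota add0n hI => /(_ isT)/allP/(_ J).
  rewrite mem_iota add0n hJ => /(_ isT)/allP/(_ L).
  rewrite mem_iota add0n hL => /(_ isT)/orP[/andP[/eqP IJ /eqP JL]|].
    subst I L; have ee : e = e' by nia.
    subst e'; by have /ternary_three_free -> : ternary x + ternary z = 2 * ternary y by lia.
  rewrite /triple_gap => /andP[/Z.leb_le h1 /Z.leb_le h2].
  rewrite !ET // EM in h1 h2.
  exfalso; set m := q I J L in h1 h2.
  have [h|h] : (Z.of_nat e' - Z.of_nat e - m <= 0 \/ 1 <= Z.of_nat e' - Z.of_nat e - m)%BZ by lia.
  + by nia.
  + by nia.
move=> c hc.
have [|[[i j] m] [/= /andP[ij hj]]] := chainedP chr cov (c := Z.of_nat c); first lia.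
have oK : odd (3 ^ k) by rewrite oddX orbT.
have hi := leq_ltn_trans ij hj.
have Ti := Tle _ hi; have Tj := Tle _ hj.
rewrite /lower2 /upper2 /= EK EM !ET // => h.
(* Here u is the distance of c from [mid]. Within a single block x <= y is required, hence the last
   clause. *)
have digits u : (- Z.of_nat (3 ^ k) < 2 * u)%BZ -> (u < Z.of_nat (3 ^ k))%BZ ->
    exists x y, [/\ x < 2 ^ k, y < 2 ^ k, (u + Z.of_nat (ternary x) = 2 * Z.of_nat (ternary y))%BZ
      & (0 <= u)%BZ -> x <= y].
  move=> u1 u2; case: (Z.le_gt_cases 0 u) => u0.
    have [|x [y [xy hy E]]] := @ternary_cover k (Z.to_nat u); first lia.
    by exists x, y; split=> //; lia.
  have [|x [y [hx hy E]]] := @ternary_cover_neg k (Z.to_nat (- u)); first lia.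
  by exists x, y; split=> //; lia.
case: (ltngtP i j) ij h => // [ij|Eij] _ h.
  have [||x [y [hx hy E _]]] := digits (Z.of_nat c - (2 * Z.of_nat (T j) - Z.of_nat (T i) + m * Z.of_nat M))%BZ.
  - lia.
  - lia.
  (* All elements lie below N, so m >= -1; the shift by N in [modular_cover] compensates this. *)
  have m0 : (0 <= m + 1)%BZ by nia.
  right; exists (i * 2 ^ k + x), (j * 2 ^ k + y), (Z.to_nat (m + 1)).
  by rewrite !fE //; split; [nia | exact: join_idx | nia].
subst j; have [||x [y [hx hy E xy]]] := digits (Z.of_nat c - (Z.of_nat (T i) + m * Z.of_nat M))%BZ.
- lia.
- lia.
have {}xy : x <= y by apply: xy; lia.
have m0 : (0 <= m + 1)%BZ by nia.
(* If x = y, then c is congruent to the element [T i + ternary x], hence equal to it. *)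
move: xy; rewrite leq_eqVlt => /orP[/eqP xy|xy].
  left; exists (i * 2 ^ k + x); rewrite ?fE //; first exact: join_idx.
  have bx := ternary_bound hx; subst y.
  have lt : T i + ternary x < M by lia.
  have Ec : (Z.of_nat c = Z.of_nat (T i + ternary x) + m * Z.of_nat M)%BZ by lia.
  have {}m0 : m = 0%BZ by clear -hc lt Ec; nia.
  by subst m; lia.
right; exists (i * 2 ^ k + x), (i * 2 ^ k + y), (Z.to_nat (m + 1)).
by rewrite !fE //; split; [lia | exact: join_idx | nia].
Qed.

(** * Cones of block unions *)

Definition config_of_seq (v : Z * Z * seq Z) : config :=
  Config v.1.1 v.1.2 (nth 0%BZ v.2).

Definition config_sum (cs : seq nat) (V : seq config) : config :=
  foldr (fun cp => config_addn cp.2 cp.1) config0 (zip cs V).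

(** Greedy interval covering: a link must start in time for every generator, and the one reaching
    farthest in [p] is taken. The result is a mere certificate, checked by [valid] in
    [cone_valid]. *)
Fixpoint greedy_chain (fuel : nat) (V : seq config) (p : config) (es : seq Z)
    (cand : seq (nat * nat * Z)) : seq (nat * nat * Z) :=
  if fuel is fuel'.+1 then
    if all2 (fun v e => (2 * period v <=? e)%BZ) V es then [::] else
    if [seq x <- cand | all2 (fun v e => (lower2 v x <=? e)%BZ) V es] is x :: s then
      let y := foldl (fun y z => if (upper2 p y <? upper2 p z)%BZ then z else y) x s in
      y :: greedy_chain fuel' V p [seq upper2 v y | v <- V] cand
    else [::]
  else [::].

(* The quotients and the chain are read off an interior vector of the cone. *)
Definition cone_valid (r : nat) (V : seq config) : bool :=
  let n := 2 ^ r in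
  let p := config_sum (nseq (size V) 1) V in
  let pairs := [seq (i, j) | i <- iota 0 n, j <- iota i (n - i)] in
  (* For i <= j the differences 2y - x with x <= y lie in [0, 2N[, so only these two shifts bring
     them into [0, N[. *)
  let cand := [seq (ij, q) | ij <- pairs, q <- [:: 0%BZ; (-1)%BZ]] in
  let ch := greedy_chain (Z.to_nat (period p)) V p (nseq (size V) 0%BZ) cand in
  let q i j l := ((offset p i + offset p l - 2 * offset p j) / period p)%BZ in
  all (fun x => x.1.1 <= x.1.2 < n) ch && all (valid n q ch) V.

Definition level (r : nat) (p : config) : Z :=
  (2 * offset p (2 ^ r).-1 + width p - period p)%BZ.

Definition weighted_sum (cs : seq nat) (ws : seq Z) : Z :=
  foldr (fun cw s => Z.of_nat cw.1 * cw.2 + s)%BZ 0%BZ (zip cs ws).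

Lemma width_config_sum cs V :
  width (config_sum cs V) = weighted_sum cs [seq width v | v <- V].
Proof.
by elim: cs V => [|c cs IH] [|v V] //; rewrite /weighted_sum /= -/(weighted_sum _ _) -IH.
Qed.

Lemma level_config_sum r cs V :
  level r (config_sum cs V) = weighted_sum cs [seq level r v | v <- V].
Proof.
elim: cs V => [|c cs IH] [|v V] //; rewrite /weighted_sum /= -/(weighted_sum _ _) -IH.
rewrite /level /config_sum /=; lia.
Qed.

Lemma valid_config_sum n q ch cs V :
  all (valid n q ch) V -> valid n q ch (config_sum cs V).
Proof.
elim: cs V => [|c cs IH] [|v V] h; try exact: valid0.
by case/andP: h => hv hV; apply: (valid_addn c hv); exact: IH.
Qed.

(** Validity holds throughout the cone, which leaves two linear equations for the coefficients
    [cs]. *)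
Lemma cone_character r V cs k lambda :
  cone_valid r V ->
  weighted_sum cs [seq width v | v <- V] = Z.of_nat (3 ^ k) ->
  weighted_sum cs [seq level r v | v <- V] = Z.of_nat lambda ->
  is_character lambda.
Proof.
rewrite -width_config_sum -level_config_sum => /andP[hch hV] EK El.
exact: (valid_modular hch (valid_config_sum cs hV) EK (esym El)).
Qed.

(** * Nine explicit cones and the sporadic vectors *)

Definition cone2 : seq config := map config_of_seq [::
  (1, 3, [:: 0; 2]);
  (2, 7, [:: 0; 5])]%BZ.

(** In each cone the first generator has width 1 and the level that names the cone; the others have
    width 2. Replacing two copies of the first by one other keeps the width and here raises the
    level by 5 - 2 * 2 = 1. *)
Lemma cone2_character k a : 2 * a <= 3 ^ k ->
  is_character (2 * 3 ^ k + a).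
Proof.
move=> h; apply: (@cone_character 1 cone2 [:: 3 ^ k - 2 * a; a] k).
- by vm_compute.
- by rewrite /weighted_sum /=; lia.
have -> : [seq level 1 v | v <- cone2] = [:: 2; 5]%BZ by vm_compute.
by rewrite /weighted_sum /=; lia.
Qed.

Definition cone4 : seq config := map config_of_seq [::
  (1, 9, [:: 0; 2; 5; 6]);
  (2, 21, [:: 0; 5; 12; 14])]%BZ.

Lemma cone4_character k a : 2 * a <= 3 ^ k ->
  is_character (4 * 3 ^ k + a).
Proof.
move=> h; apply: (@cone_character 2 cone4 [:: 3 ^ k - 2 * a; a] k).
- by vm_compute.
- by rewrite /weighted_sum /=; lia.
have -> : [seq level 2 v | v <- cone4] = [:: 4; 9]%BZ by vm_compute.
by rewrite /weighted_sum /=; lia.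
Qed.

Definition cone8 : seq config := map config_of_seq [::
  (1, 9, [:: 0; 3; 5; 8]);
  (2, 21, [:: 0; 7; 12; 19]);
  (2, 23, [:: 0; 8; 13; 21])]%BZ.

Lemma cone8_character k a b : 2 * (a + b) <= 3 ^ k ->
  is_character (8 * 3 ^ k + 3 * a + 5 * b).
Proof.
move=> h; apply: (@cone_character 2 cone8 [:: 3 ^ k - 2 * (a + b); a; b] k).
- by vm_compute.
- by rewrite /weighted_sum /=; lia.
have -> : [seq level 2 v | v <- cone8] = [:: 8; 19; 21]%BZ by vm_compute.
by rewrite /weighted_sum /=; lia.
Qed.

Definition cone12 : seq config := map config_of_seq [::
  (1, 27, [:: 0; 3; 4; 9; 10; 12; 13; 19]);
  (2, 57, [:: 0; 6; 8; 19; 21; 25; 27; 40]);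
  (2, 62, [:: 0; 7; 9; 21; 23; 28; 30; 44])]%BZ.

Lemma cone12_character k a b : 2 * (a + b) <= 3 ^ k ->
  is_character (12 * 3 ^ k + a + 4 * b).
Proof.
move=> h; apply: (@cone_character 3 cone12 [:: 3 ^ k - 2 * (a + b); a; b] k).
- by vm_compute.
- by rewrite /weighted_sum /=; lia.
have -> : [seq level 3 v | v <- cone12] = [:: 12; 25; 28]%BZ by vm_compute.
by rewrite /weighted_sum /=; lia.
Qed.

Definition cone14 : seq config := map config_of_seq [::
  (1, 27, [:: 0; 3; 8; 9; 11; 12; 17; 20]);
  (2, 57, [:: 0; 6; 17; 19; 23; 25; 36; 42])]%BZ.

Lemma cone14_character k a : 2 * a <= 3 ^ k ->
  is_character (14 * 3 ^ k + a).
Proof.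
move=> h; apply: (@cone_character 3 cone14 [:: 3 ^ k - 2 * a; a] k).
- by vm_compute.
- by rewrite /weighted_sum /=; lia.
have -> : [seq level 3 v | v <- cone14] = [:: 14; 29]%BZ by vm_compute.
by rewrite /weighted_sum /=; lia.
Qed.

Definition cone14' : seq config := map config_of_seq [::
  (1, 27, [:: 0; 3; 5; 9; 11; 12; 14; 20]);
  (2, 63, [:: 0; 7; 12; 21; 26; 28; 33; 47]);
  (2, 66, [:: 0; 7; 12; 22; 27; 29; 34; 49])]%BZ.

Lemma cone14'_character k a b : 2 * (a + b) <= 3 ^ k ->
  is_character (14 * 3 ^ k + 5 * a + 6 * b).
Proof.
move=> h; apply: (@cone_character 3 cone14' [:: 3 ^ k - 2 * (a + b); a; b] k).
- by vm_compute.
- by rewrite /weighted_sum /=; lia.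
have -> : [seq level 3 v | v <- cone14'] = [:: 14; 33; 34]%BZ by vm_compute.
by rewrite /weighted_sum /=; lia.
Qed.

Definition cone16 : seq config := map config_of_seq [::
  (1, 27, [:: 0; 3; 5; 8; 14; 17; 18; 21]);
  (2, 60, [:: 0; 7; 11; 18; 31; 38; 40; 47]);
  (2, 63, [:: 0; 7; 12; 19; 33; 40; 42; 49])]%BZ.

Lemma cone16_character k a b : 2 * (a + b) <= 3 ^ k ->
  is_character (16 * 3 ^ k + 4 * a + 5 * b).
Proof.
move=> h; apply: (@cone_character 3 cone16 [:: 3 ^ k - 2 * (a + b); a; b] k).
- by vm_compute.
- by rewrite /weighted_sum /=; lia.
have -> : [seq level 3 v | v <- cone16] = [:: 16; 36; 37]%BZ by vm_compute.
by rewrite /weighted_sum /=; lia.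
Qed.

Definition cone22 : seq config := map config_of_seq [::
  (1, 29, [:: 0; 2; 3; 5; 20; 22; 23; 25]);
  (2, 59, [:: 0; 4; 6; 10; 41; 45; 47; 51]);
  (2, 69, [:: 0; 5; 7; 12; 48; 53; 55; 60])]%BZ.

Lemma cone22_character k a b : 2 * (a + b) <= 3 ^ k ->
  is_character (22 * 3 ^ k + a + 9 * b).
Proof.
move=> h; apply: (@cone_character 3 cone22 [:: 3 ^ k - 2 * (a + b); a; b] k).
- by vm_compute.
- by rewrite /weighted_sum /=; lia.
have -> : [seq level 3 v | v <- cone22] = [:: 22; 45; 53]%BZ by vm_compute.
by rewrite /weighted_sum /=; lia.
Qed.

Definition cone29 : seq config := map config_of_seq [::
  (1, 30, [:: 0; 3; 5; 8; 21; 24; 26; 29]);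
  (2, 71, [:: 0; 7; 12; 19; 50; 57; 62; 69]);
  (2, 78, [:: 0; 8; 13; 21; 55; 63; 68; 76]);
  (2, 70, [:: 0; 7; 12; 19; 49; 56; 61; 68])]%BZ.

Lemma cone29_character k a b c : 2 * (a + b + c) <= 3 ^ k ->
  is_character (29 * 3 ^ k + 11 * a + 18 * b + 10 * c).
Proof.
move=> h; apply: (@cone_character 3 cone29 [:: 3 ^ k - 2 * (a + b + c); a; b; c] k).
- by vm_compute.
- by rewrite /weighted_sum /=; lia.
have -> : [seq level 3 v | v <- cone29] = [:: 29; 69; 76; 68]%BZ by vm_compute.
by rewrite /weighted_sum /=; lia.
Qed.

(* The entry (r, k, (N, t)) stands for 2^r blocks of width 3^k. *)
Definition sporadic : seq (nat * nat * (Z * seq Z)) := [::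
  (3, 0, (27, [:: 0; 1; 4; 6; 10; 13; 15; 18])%BZ);
  (3, 0, (28, [:: 0; 4; 5; 9; 15; 17; 20; 22])%BZ);
  (3, 0, (32, [:: 0; 2; 3; 5; 23; 25; 26; 28])%BZ);
  (3, 0, (31, [:: 0; 1; 7; 8; 21; 22; 28; 29])%BZ);
  (3, 0, (34, [:: 0; 3; 4; 7; 25; 28; 29; 32])%BZ);
  (4, 0, (90, [:: 0; 3; 7; 10; 21; 24; 28; 30; 31; 33; 37; 40; 51; 54; 58; 61])%BZ);
  (4, 0, (81, [:: 0; 1; 3; 4; 18; 19; 21; 22; 31; 45; 46; 48; 49; 54; 55; 57])%BZ);
  (4, 0, (84, [:: 0; 5; 11; 15; 16; 20; 26; 28; 31; 33; 39; 43; 44; 48; 54; 59])%BZ);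
  (3, 1, (86, [:: 0; 16; 19; 29; 35; 45; 48; 64])%BZ);
  (3, 1, (87, [:: 0; 10; 26; 29; 36; 39; 55; 65])%BZ);
  (3, 1, (84, [:: 0; 3; 9; 12; 31; 40; 56; 65])%BZ);
  (3, 1, (85, [:: 0; 6; 29; 35; 44; 47; 73; 76])%BZ);
  (3, 1, (90, [:: 0; 3; 13; 20; 33; 43; 60; 80])%BZ);
  (3, 1, (85, [:: 0; 3; 19; 22; 57; 60; 76; 79])%BZ);
  (3, 1, (88, [:: 0; 3; 20; 23; 59; 62; 79; 82])%BZ);
  (3, 1, (94, [:: 0; 7; 21; 28; 63; 70; 84; 91])%BZ);
  (3, 1, (97, [:: 0; 10; 16; 26; 68; 78; 84; 94])%BZ);
  (5, 0, (243, [:: 0; 12; 17; 29; 30; 35; 36; 47; 54; 62; 66; 71; 74; 81; 83; 84; 90; 93; 98; 110; 111; 116; 117; 128; 135; 143; 147; 152; 155; 164; 165; 171])%BZ);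
  (4, 1, (246, [:: 0; 3; 9; 12; 55; 58; 64; 67; 94; 137; 140; 146; 149; 164; 167; 173])%BZ);
  (5, 0, (243, [:: 0; 1; 18; 28; 30; 37; 40; 45; 54; 57; 58; 64; 66; 67; 81; 82; 85; 93; 99; 109; 111; 118; 121; 126; 135; 138; 139; 145; 147; 148; 166; 174])%BZ);
  (3, 2, (258, [:: 0; 28; 77; 86; 105; 114; 163; 191])%BZ);
  (3, 2, (264, [:: 0; 30; 79; 88; 109; 118; 167; 197])%BZ);
  (3, 2, (246, [:: 0; 9; 27; 36; 91; 118; 164; 191])%BZ);
  (3, 2, (254, [:: 0; 66; 85; 94; 113; 151; 179; 198])%BZ);
  (3, 2, (252, [:: 0; 9; 37; 56; 93; 121; 168; 224])%BZ);
  (3, 2, (258, [:: 0; 19; 87; 106; 134; 143; 221; 230])%BZ);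
  (3, 2, (281, [:: 0; 20; 29; 49; 194; 214; 223; 243])%BZ);
  (3, 2, (247, [:: 0; 9; 55; 64; 165; 174; 220; 229])%BZ);
  (3, 2, (292, [:: 0; 21; 30; 51; 202; 223; 232; 253])%BZ);
  (3, 2, (289, [:: 0; 21; 97; 119; 161; 183; 259; 280])%BZ);
  (3, 2, (295, [:: 0; 22; 66; 88; 198; 220; 264; 286])%BZ);
  (3, 2, (304, [:: 0; 23; 102; 125; 170; 193; 272; 295])%BZ);
  (3, 2, (307, [:: 0; 23; 103; 127; 171; 195; 275; 298])%BZ);
  (3, 2, (322, [:: 0; 33; 54; 87; 226; 259; 280; 313])%BZ);
  (3, 2, (325, [:: 0; 33; 54; 88; 228; 262; 283; 316])%BZ);
  (3, 2, (331, [:: 0; 34; 55; 89; 233; 267; 288; 322])%BZ);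
  (3, 3, (762, [:: 0; 85; 227; 254; 312; 339; 481; 566])%BZ)].

Definition sporadic_config (e : nat * nat * (Z * seq Z)) : config :=
  config_of_seq (Z.of_nat (3 ^ e.1.2), e.2.1, e.2.2).

Lemma sporadic_valid :
  all (fun e => cone_valid e.1.1 [:: sporadic_config e]) sporadic.
Proof. by vm_compute. Qed.

Lemma sporadic_character lambda :
  has (fun e => level e.1.1 (sporadic_config e) =? Z.of_nat lambda)%BZ sporadic ->
  is_character lambda.
Proof.
elim: sporadic sporadic_valid => //= e s IH /andP[he hs] /orP[/Z.eqb_eq E|]; last exact: IH.
apply: (cone_character (cs := [:: 1]) he (k := e.1.2)); rewrite /weighted_sum /=; lia.
Qed.

(** * Characters congruent to 1 modulo 3 *)

Local Ltac zlia := zify; Z.to_euclidean_division_equations; lia.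

Definition exceptional : seq nat := [:: 1; 3; 5; 9; 11; 15].

(* In three of the cones the excess x over the base value (and over 18 b in the
   last cone) is m u + (m + 1) v with u + v = s; these numbers fill
   [m s, (m + 1) s], whence the choice s = ceil (x / (m + 1)).  With 3 u + 5 v,
   s must moreover have the parity of x. *)
Definition covered (l K : Z) : bool :=
  let between a x b := (a <=? x)%BZ && (x <=? b)%BZ in
  [|| let x := (l - 2 * K)%BZ in between 0%BZ (2 * x)%BZ K,
      let x := (l - 4 * K)%BZ in between 0%BZ (2 * x)%BZ K,
      let x := (l - 8 * K)%BZ in let s := ((x + 4) / 5)%BZ in
      let t := (s + (x - 3 * s) mod 2)%BZ in between 0%BZ (3 * t)%BZ x && (2 * t <=? K)%BZ,
      let x := (l - 12 * K)%BZ in (0 <=? x)%BZ && (2 * (x mod 4 + x / 4) <=? K)%BZ,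
      let x := (l - 14 * K)%BZ in between 0%BZ (2 * x)%BZ K,
      let x := (l - 14 * K)%BZ in let s := ((x + 5) / 6)%BZ in
      between 0%BZ (5 * s)%BZ x && (2 * s <=? K)%BZ,
      let x := (l - 16 * K)%BZ in let s := ((x + 4) / 5)%BZ in
      between 0%BZ (4 * s)%BZ x && (2 * s <=? K)%BZ,
      let x := (l - 22 * K)%BZ in (0 <=? x)%BZ && (2 * (x mod 9 + x / 9) <=? K)%BZ
    | has (fun b => let x := (l - 29 * K - 18 * Z.of_nat b)%BZ in let s := ((x + 10) / 11)%BZ in
        between 0%BZ (10 * s)%BZ x && (2 * (Z.of_nat b + s) <=? K)%BZ) (iota 0 8)].

Lemma covered_character lambda k :
  covered (Z.of_nat lambda) (Z.of_nat (3 ^ k)) -> is_character lambda.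
Proof.
rewrite /covered; set l := Z.of_nat lambda; set K := Z.of_nat (3 ^ k); cbv beta zeta.
case/orP => [|].
  set x := (l - _)%BZ => h; have -> : lambda = 2 * 3 ^ k + Z.to_nat x by zlia.
  by apply: cone2_character; zlia.
case/orP => [|].
  set x := (l - _)%BZ => h; have -> : lambda = 4 * 3 ^ k + Z.to_nat x by zlia.
  by apply: cone4_character; zlia.
case/orP => [|].
  set x := (l - _)%BZ; set s := ((x + 4) / 5)%BZ; set t := (s + _)%BZ => h.
  (* This is v = (x - 3t) / 2, the solution of u + v = t and 3u + 5v = x. *)
  set b := ((x - 3 * s) / 2 - (x - 3 * s) mod 2)%BZ.
  have -> : lambda = 8 * 3 ^ k + 3 * Z.to_nat (t - b) + 5 * Z.to_nat b by zlia.
  by apply: cone8_character; zlia.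
case/orP => [|].
  set x := (l - _)%BZ => h.
  have -> : lambda = 12 * 3 ^ k + Z.to_nat (x mod 4)%BZ + 4 * Z.to_nat (x / 4)%BZ by zlia.
  by apply: cone12_character; zlia.
case/orP => [|].
  set x := (l - _)%BZ => h; have -> : lambda = 14 * 3 ^ k + Z.to_nat x by zlia.
  by apply: cone14_character; zlia.
case/orP => [|].
  set x := (l - _)%BZ; set s := ((x + 5) / 6)%BZ => h.
  have -> : lambda = 14 * 3 ^ k + 5 * Z.to_nat (6 * s - x)%BZ + 6 * Z.to_nat (x - 5 * s)%BZ by zlia.
  by apply: cone14'_character; zlia.
case/orP => [|].
  set x := (l - _)%BZ; set s := ((x + 4) / 5)%BZ => h.
  have -> : lambda = 16 * 3 ^ k + 4 * Z.to_nat (5 * s - x)%BZ + 5 * Z.to_nat (x - 4 * s)%BZ by zlia.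
  by apply: cone16_character; zlia.
case/orP => [|].
  set x := (l - _)%BZ => h.
  have -> : lambda = 22 * 3 ^ k + Z.to_nat (x mod 9)%BZ + 9 * Z.to_nat (x / 9)%BZ by zlia.
  by apply: cone22_character; zlia.
case/hasP => b _; set x := (l - _ - _)%BZ; set s := ((x + 10) / 11)%BZ => h.
have -> : lambda = 29 * 3 ^ k + 11 * Z.to_nat (x - 10 * s)%BZ + 18 * b + 10 * Z.to_nat (11 * s - x)%BZ by zlia.
by apply: cone29_character; zlia.
Qed.

(** The bound 972 = 12 * 3^4 is where [large_character] takes over. *)
Lemma small_character : all (fun l =>
  [|| l \in exceptional, (l %% 3 != 1) && (l %/ 3 \notin exceptional),
      has (covered (Z.of_nat l)) [:: 1; 3; 9; 27; 81; 243]%BZ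
    | has (fun e => level e.1.1 (sporadic_config e) =? Z.of_nat l)%BZ sporadic]) (iota 0 972).
Proof. by vm_compute. Qed.

(** The set {0} modulo 1 yields S({0}) itself. *)
Lemma is_character0 : is_character 0.
Proof.
exists 0, 1, (fun=> 0); split=> //; split=> //; try by case=> [|i] [].
by case=> // _; left; exists 0.
Qed.

(** Choose K = 3^k with 12 K <= lambda < 36 K. In units of K this range is cut at 14, 14.5, 16.5,
    18, 22.5, 24.5 and 31; the pieces belong to [cone12], [cone14], [cone14'], [cone16], [cone2] at
    width 9 K, [cone22], [cone8] at width 3 K, and [cone29]. *)
Lemma large_character lambda : 972 <= lambda -> lambda %% 3 = 1 -> is_character lambda.
Proof.
move=> h1 h3; set k := trunc_log 3 (lambda %/ 12).
have [] := andP (@trunc_log_bounds 3 (lambda %/ 12) isT ltac:(lia)); rewrite -/k expnS.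
have k4 : 4 <= k by apply: trunc_log_max => //; rewrite (_ : 3 ^ 4 = 81) //; lia.
have [j Ej] : exists j, 3 ^ k = 3 * j by exists (3 ^ k.-1); rewrite -expnS prednK //; lia.
(* At widths 81 and 243 rounding leaves no slack in the last cone, so the exact values are kept. *)
have K81 : 3 ^ k = 81 \/ 3 ^ k = 243 \/ 729 <= 3 ^ k.
  case: (ltngtP k 5) => k5; [|right; right; by rewrite (_ : 729 = 3 ^ 6) ?leq_exp2l|by rewrite k5; right; left].
  by left; have -> : k = 4 by lia.
have oK : odd (3 ^ k) by rewrite oddX orbT.
move=> lo hi; pose K := Z.of_nat (3 ^ k); pose l := Z.of_nat lambda.
case: (ltnP lambda (18 * 3 ^ k)) => h18.
  apply: (@covered_character _ k); rewrite /covered; cbv beta zeta; rewrite -/K -/l.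
  case: (ltnP lambda (14 * 3 ^ k)) => h14.
    (* Close to 14 * 3^k the bound on [x mod 4 + x / 4] relies on x being 1 modulo 3. *)
    by do 3 (apply/orP; right); apply/orP; left; zlia.
  case: (leqP (2 * (lambda - 14 * 3 ^ k)) (3 ^ k)) => h145.
    by do 4 (apply/orP; right); apply/orP; left; zlia.
  case: (leqP (2 * (lambda - 16 * 3 ^ k)) (3 ^ k)) => h165.
    by do 5 (apply/orP; right); apply/orP; left; zlia.
  by do 6 (apply/orP; right); apply/orP; left; zlia.
case: (leqP (2 * (lambda - 18 * 3 ^ k)) (9 * 3 ^ k)) => h225.
  by apply: (@covered_character _ k.+2); rewrite /covered !expnS; apply/orP; left; zlia.
case: (leqP (2 * (lambda - 24 * 3 ^ k)) (3 ^ k)) => h245.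
  apply: (@covered_character _ k); rewrite /covered; cbv beta zeta; rewrite -/K -/l.
  by do 7 (apply/orP; right); apply/orP; left; zlia.
case: (ltnP lambda (31 * 3 ^ k)) => h31.
  apply: (@covered_character _ k.+1); rewrite /covered expnS; cbv beta zeta.
  by do 2 (apply/orP; right); apply/orP; left; zlia.
(* The multiple 18 b uses up most of the excess over 29 K when the latter is large. *)
have [b [hb hb']] : exists b, 18 * b <= lambda - 29 * 3 ^ k /\
    let x := lambda - 29 * 3 ^ k - 18 * b in let s := (x + 10) %/ 11 in
    10 * s <= x /\ 2 * (b + s) <= 3 ^ k.
  case: (leqP (2 * (lambda - 29 * 3 ^ k)) (10 * 3 ^ k)) => h34.
    by exists 4; lia.
  (* Here 18 b = 4 * 3^k, which leaves an excess between 3^k and 3 * 3^k. *)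
  by exists (2 * 3 ^ k %/ 9); lia.
set x := lambda - _ - _ in hb'; set s := (x + 10) %/ 11 in hb'.
have -> : lambda = 29 * 3 ^ k + 11 * (x - 10 * s) + 18 * b + 10 * (11 * s - x) by lia.
by apply: cone29_character; lia.
Qed.

(** Strong induction through [lambda %/ 3] for residues 0 and 2; an exceptional quotient forces
    lambda <= 47, within the range of [small_character]. *)
Lemma character_all lambda : lambda \notin exceptional -> is_character lambda.
Proof.
elim/ltn_ind: lambda => lambda IH hl.
case: (posnP lambda) => [->|l0]; first exact: is_character0.
have reduce : lambda %% 3 != 1 -> lambda %/ 3 \notin exceptional -> is_character lambda.
  move=> h3 hex; have {}IH := IH (lambda %/ 3) ltac:(lia) hex.
  by rewrite (_ : lambda = 3 * (lambda %/ 3) + (lambda %% 3 == 2).*2); [exact: is_character_triple | lia].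
case: (ltnP lambda 972) => big.
  have := allP small_character lambda; rewrite mem_iota => /(_ big).
  rewrite (negbTE hl) /= => /or3P[/andP[h3 hex]|h|].
  - exact: reduce.
  - have [k hk] : exists k, covered (Z.of_nat lambda) (Z.of_nat (3 ^ k)).
      by move: h; rewrite /= orbF => /or4P[|||/or3P[]]; [exists 0|exists 1|exists 2|exists 3|exists 4|exists 5].
    exact: covered_character hk.
  - exact: sporadic_character.
case: (boolP (lambda %% 3 == 1)) => [/eqP h3|h3].
  exact: large_character.
apply: reduce => //; rewrite !inE; lia.
Qed.

Unset Implicit Arguments.

Theorem theorem9 (lambda : nat)
  (hlambda : lambda \notin [:: 1; 3; 5; 9; 11; 15]) :
  exists (A : seq nat) (a : nat -> nat),
    [/\ stanley A a, independent a & has_character a (Posz lambda)].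
Proof. exact: is_character_stanley (character_all hlambda). Qed.
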